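(* Let $G$ be a countable commutative group. A subset $A\subseteq G$ belongs to some free Schur ultrafilter on $G$ if and only if $A$ is a Schur set.
   Context: An ultrafilter $u$ on a commutative group $G$ is Schur if for each $U\in u$ there exist $a,b\in U$ with $a+b\in U$; it is free if the intersection of its members is empty. An $r$-coloring of a set $X$ is a surjective function $c:X\to\{1,\dots,r\}$; a subset is monochromatic if $c$ is constant on it. A subset $A=\{x_n:n\in\mathbb N\}$ of a countable commutative group $G$ (given with an enumeration) is called Schur if for every $r,k\in\mathbb N$ there exists a number $S(r,k)\in\mathbb N$ such that for every $r$-coloring of $X=\{x_n:n\le S(r,k)\}$ there exist $a\in X$ and $\{b_1,\dots,b_k\}\subseteq X$ such that $\{a\}\cup\{b_1,\dots,b_k\}\cup\{a+b_i:i\le k\}$ is a monochromatic subset of $X$. (Being Schur does not depend on the chosen enumeration.)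
   Formalization: In the definition of a Schur set, S(r,k) must also make X have at least r elements; otherwise X may have no (surjective) r-coloring, the condition is vacuous for r ≥ 2, and the odd integers together with 2 are a counterexample. The b_i are taken pairwise distinct. *)

(* Defs.v *)
From HB Require Import structures.
From mathcomp Require Import all_boot all_order all_algebra.
From mathcomp Require Import boolp classical_sets functions cardinality filter.

Set Implicit Arguments.
Unset Strict Implicit.
Unset Printing Implicit Defensive.

Import GRing.Theory.

Local Open Scope classical_set_scope.
Local Open Scope card_scope.
Local Open Scope ring_scope.

Definition schur_ultrafilter (G : zmodType) (u : set_system G) : Prop :=
  UltraFilter u /\
  forall U : set G, u U -> exists a b : G, [/\ U a, U b & U (a + b)].

Definition free_filter (T : Type) (u : set_system T) : Prop :=
  \bigcap_(U in u) U = set0.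

(* Colors are elements of 'I_r.  A coloring of X is represented by a function
   defined on all of T, of which only the restriction to X is ever used. *)
Definition is_coloring (T : Type) (r : nat) (X : set T) (c : T -> 'I_r) : Prop :=
  set_surj X [set: 'I_r] c.

Definition monochromatic (T : Type) (r : nat) (X : set T) (c : T -> 'I_r)
    (Y : set T) : Prop :=
  Y `<=` X /\ forall y z : T, Y y -> Y z -> c y = c z.

(* The elements b_1, ..., b_k are pairwise distinct, but some b_i may equal a. *)
Definition schur_configuration (G : zmodType) (r k : nat) (X : set G)
    (c : G -> 'I_r) : Prop :=
  exists (a : G) (b : 'I_k -> G),
    injective b /\
    monochromatic X c
      ([set a] `|` range b `|` range (fun i : 'I_k => a + b i)).

Definition initial_segment (T : Type) (x : nat -> T) (n : nat) : set T :=
  x @` [set i | (i <= n)%N].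

(* Colorings are surjective, so a set with fewer than r elements has none.  The
   requirement `I_r #<= X keeps the condition on S from holding vacuously, in
   which case for r >= 2 it would always be satisfied by S = 0.  Given this
   requirement, surjective and arbitrary colorings by r colors lead to the same
   condition: on a set with at least r elements every coloring is refined by a
   surjective one. *)
Definition schur_sequence (G : zmodType) (x : nat -> G) : Prop :=
  forall r k : nat, exists S : nat,
    let X := initial_segment x S in
    `I_r #<= X /\
    forall c : G -> 'I_r, is_coloring X c -> schur_configuration k X c.

(* Enumerations may have repetitions; the empty set has none, so it is not a
   Schur set. *)
Definition schur_set (G : zmodType) (A : set G) : Prop :=
  exists x : nat -> G, A = range x /\ schur_sequence x.

(* Main.v *)
(* If a set U in a free Schur ultrafilter contained no a, b_1, ..., b_k,
   a + b_1, ..., a + b_k, then the digraph on G with edges a -> b for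
   a, b, a + b in U and a -> 2a would have out-degree at most k, hence a proper
   coloring with 2k + 1 colors; the color class in the ultrafilter would contain
   no a, b, a + b.  Compactness makes this finitary.  Conversely, the sets for
   which every finite coloring has a class with such configurations for all k
   are partition regular, so each of them belongs to an ultrafilter consisting
   of such sets. *)

Require Import Defs.
From mathcomp Require Import all_boot all_order all_algebra.
From mathcomp Require Import boolp classical_sets functions cardinality filter.

Set Implicit Arguments.
Unset Strict Implicit.
Unset Printing Implicit Defensive.

Import GRing.Theory.

Local Open Scope classical_set_scope.

(** * Colorings of finite digraphs of bounded out-degree *)

Lemma ord_avoid n (s : seq 'I_n) : (size s < n)%N -> exists j, j \notin s.
Proof.
move=> ltsn; apply/existsP; rewrite -[X in is_true X]negbK negb_exists.
apply/negP => /forallP alls; move: ltsn; rewrite ltnNge => /negP; apply.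
have := @uniq_leq_size _ (enum 'I_n) s (enum_uniq _).
rewrite size_enum_ord; apply=> j _.
by have := alls j; rewrite negbK.
Qed.

(** Double counting of edges: in-degrees and out-degrees have the same sum over [s], at most [d]
    times the size of [s]. *)
Lemma exists_small_indegree (T : eqType) (e : rel T) d (s : seq T) :
  s != [::] -> {in s, forall v, (count (e v) s <= d)%N} ->
  exists2 v, v \in s & (count (e^~ v) s <= d)%N.
Proof.
move=> s0 outd; apply/hasP; rewrite -[X in is_true X]negbK -all_predC.
apply/negP => /allP ind.
have : (\sum_(v <- s) d.+1 <= \sum_(v <- s) d)%N.
  apply: (@leq_trans (\sum_(v <- s) count (e^~ v) s)).
    rewrite big_seq [X in (_ <= X)%N]big_seq; apply: leq_sum => v vs.
    by have := ind v vs; rewrite /= -ltnNge.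
  under eq_bigr do rewrite -sum1_count big_mkcond.
  rewrite exchange_big /=.
  rewrite big_seq [X in (_ <= X)%N]big_seq; apply: leq_sum => v vs.
  by rewrite -big_mkcond sum1_count; apply: outd.
rewrite !big_const_seq !count_predT !iter_addn_0 leq_mul2r ltnn orbF.
by rewrite size_eq0 (negbTE s0).
Qed.

(** Delete a vertex of in-degree at most [d] and induct: it has at most [2d] in- and out-neighbours,
    so one of the [2d + 1] colors is free for it. *)
Lemma sparse_digraph_coloring (T : eqType) (e : rel T) d (s : seq T) :
  uniq s -> {in s, forall v, (count (e v) s <= d)%N} ->
  exists c : T -> 'I_(d.*2.+1),
    {in s &, forall v w, e v w -> v != w -> c v != c w}.
Proof.
elim: {s}(size s) {-2}s (erefl (size s)) => [|n IHn] s.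
  by move=> /size0nil -> _ _; exists (fun=> ord0).
move=> szs us outd.
have s0 : s != [::] by case: s szs {us outd}.
have [v vs ind] := exists_small_indegree s0 outd.
have subs : subseq (rem v s) s by apply: rem_subseq.
have [|||c cP] := IHn (rem v s).
- by rewrite size_rem // szs.
- by rewrite rem_uniq.
- move=> w /(mem_subseq subs) ws.
  by rewrite (leq_trans _ (outd w ws)) // leq_count_subseq.
have [|j jN] :=
    @ord_avoid _ (map c ([seq w <- s | e v w] ++ [seq w <- s | e w v])).
  by rewrite size_map size_cat !size_filter ltnS -addnn leq_add // outd.
have cj w : w \in s -> e v w || e w v -> j != c w.
  move=> ws vw; apply: contra jN => /eqP ->; apply: map_f.
  by rewrite mem_cat !mem_filter ws !andbT.
exists (fun w => if w == v then j else c w) => w z ws zs ewz wz.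
case: (eqVneq w v) => [wv|wv]; case: (eqVneq z v) => [zv|zv].
- by rewrite wv zv eqxx in wz.
- by apply: cj => //; rewrite -wv ewz.
- by rewrite eq_sym; apply: cj => //; rewrite -zv ewz orbT.
- by apply: cP => //; rewrite mem_rem_uniq // !inE ?wv ?zv.
Qed.

(** * Ultrafilters and compactness *)

Lemma ultra_color_class (T : Type) (I : finType) (u : set_system T)
    (c : T -> I) : UltraFilter u -> exists j, u (c @^-1` [set j]).
Proof.
move=> uu; apply: contrapT => nouc.
have : u (fun t => forall j, (~` (c @^-1` [set j])) t).
  apply: filter_forall => j.
  case: (in_ultra_setVsetC (c @^-1` [set j]) uu) => // uj.
  by case: nouc; exists j.
by move=> /filter_ex [t /(_ (c t))]; apply.
Qed.

Lemma free_ultrafilter_setC1 (T : Type) (u : set_system T) (t : T) :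
  UltraFilter u -> free_filter u -> u (~` [set t]).
Proof.
move=> uu fu; case: (in_ultra_setVsetC [set t] uu) => // ut.
have : (\bigcap_(V in u) V) t.
  by move=> V uV; have [z [Vz <-]] := filter_ex (filterI uV ut).
by rewrite fu.
Qed.

Lemma free_ultrafilter_infinite (T : eqType) (u : set_system T) A :
  UltraFilter u -> free_filter u -> u A -> infinite_set A.
Proof.
move=> uu fu uA /finite_seqP[s As].
have : u (~` [set` s]).
  elim: s {As} => [|g s IHs]; first by apply: filterS filterT => z _.
  have ug := free_ultrafilter_setC1 g uu fu.
  apply: filterS (filterI ug IHs) => z [/= zg zs].
  by rewrite inE => /orP[/eqP|].
by rewrite -As => uNA; have [z []] := filter_ex (filterI uA uNA).
Qed.

(* The pointwise limit of the colorings along an ultrafilter on [seq T] that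
   contains all the sets of supersequences. *)
Lemma limit_coloring (T : eqType) (I : finType) (c : seq T -> T -> I) :
  exists l : T -> I, forall s : seq T,
    exists2 s' : seq T, {subset s <= s'} & {in s, c s' =1 l}.
Proof.
pose F : set_system (seq T) :=
  [set P | exists s : seq T, forall s' : seq T, {subset s <= s'} -> P s'].
have FF : ProperFilter F.
  split; first by move=> [s /(_ s)]; apply.
  split.
  - by exists [::].
  - move=> P Q [s sP] [t tQ]; exists (s ++ t) => s' sub.
    by split; [apply: sP|apply: tQ] => z zs; apply: sub;
      rewrite mem_cat zs ?orbT.
  - by move=> P Q PQ [s sP]; exists s => s' /sP /PQ.
have [w [uw Fw]] := ultraFilterLemma FF.
have /choice[l lP] : forall t, exists j, w [set s | c s t = j].
  by move=> t; exact: (ultra_color_class (c^~ t) uw).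
exists l => s.
have ws : w [set s' | {in s, c s' =1 l}].
  elim: s => [|t s IHs]; first by apply: filterS filterT => s' _ t.
  apply: filterS (filterI (lP t) IHs) => s' [/= cl cls] z.
  by rewrite inE => /orP[/eqP ->|/cls].
have wsub : w [set s' | {subset s <= s'}] by apply: Fw; exists s.
by have [s' [ss' cs']] := filter_ex (filterI wsub ws); exists s'.
Qed.

(** Properness constrains two points at a time, so it passes from colorings of finite sets to their
    limit. *)
Lemma sparse_digraph_coloring_infinite (T : eqType) (e : rel T) d :
  (forall v (s : seq T), uniq s -> (count (e v) s <= d)%N) ->
  exists c : T -> 'I_(d.*2.+1), forall v w, e v w -> v != w -> c v != c w.
Proof.
move=> outd.
have /choice[c cP] : forall s : seq T, exists c : T -> 'I_(d.*2.+1),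
    {in s &, forall v w, e v w -> v != w -> c v != c w}.
  move=> s; have [|v _|c cP] := @sparse_digraph_coloring _ e d (undup s).
  - exact: undup_uniq.
  - by apply: outd; exact: undup_uniq.
  - by exists c => v w vs ws; apply: cP; rewrite mem_undup.
have [l lP] := limit_coloring c.
exists l => v w; have [s' ss' cs'] := lP [:: v; w].
have vs : v \in [:: v; w] by rewrite mem_head.
have ws : w \in [:: v; w] by rewrite mem_behead //= mem_head.
by rewrite -(cs' v vs) -(cs' w ws); apply: cP; apply: ss'.
Qed.

(** * Stars in members of free Schur ultrafilters *)

Local Open Scope ring_scope.

(** The pattern of [schur_configuration] freed from its coloring; for [k = 0] it only asks that [B]
    be nonempty. *)
Definition star (G : zmodType) (k : nat) (B : set G) : Prop :=
  exists (a : G) (b : 'I_k -> G),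
    [/\ injective b, B a, forall i, B (b i) & forall i, B (a + b i)].

Section Stars.
Variable G : zmodType.
Implicit Types (A B U : set G) (k : nat).

Lemma star_subset k A B : A `<=` B -> star k A -> star k B.
Proof.
by move=> AB [a [b [ib /AB Ba Bb Bab]]]; exists a, b; split=> // i; apply: AB.
Qed.

Lemma star_leq k k' B : (k <= k')%N -> star k' B -> star k B.
Proof.
move=> kk' [a [b [ib Ba Bb Bab]]]; exists a, (b \o widen_ord kk').
split=> // [i j /= /ib eq_ij|i|i]; [|exact: Bb|exact: Bab].
by apply: val_inj; exact: (congr1 val eq_ij).
Qed.

Lemma schur_configurationP r k (X : set G) (c : G -> 'I_r) :
  schur_configuration k X c <-> exists j, star k (X `&` c @^-1` [set j]).
Proof.
split=> [[a [b [ib [YX mono]]]]|[j [a [b [ib Ba Bb Bab]]]]].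
  have Y z : ([set a] `|` range b `|` range (fun i : 'I_k => a + b i)) z ->
      X z /\ c z = c a.
    by move=> Yz; split; [exact: YX|apply: mono => //; left; left].
  exists (c a), a, b; split=> //.
  - by apply: Y; left; left.
  - by move=> i; apply: Y; left; right; exists i.
  - by move=> i; apply: Y; right; exists i.
exists a, b; split=> //.
have Y z : ([set a] `|` range b `|` range (fun i : 'I_k => a + b i)) z ->
    X z /\ c z = j.
  by case=> [[->|[i _ <-]]|[i _ <-]]; [exact: Ba|exact: Bb|exact: Bab].
by split=> [z /Y[]//|y z /Y[_ ->] /Y[_ ->]].
Qed.

Lemma schur_ultrafilter_star (u : set_system G) U k :
  schur_ultrafilter u -> free_filter u -> u U -> star k U.
Proof.
move=> [uu schu] fu uU; apply: contrapT => nstar.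
pose p a b := `[< [/\ U a, U b & U (a + b)] >].
(* The edges from [a] to [a + a] serve the case [a = b] of the Schur property. *)
pose e a b := p a b || (b == a + a).
have outd a (s : seq G) : uniq s -> (count (e a) s <= k)%N.
  move=> us.
  have cp : (count (p a) s < k)%N.
    rewrite ltnNge; apply/negP => kc; apply: nstar.
    have tk i : (i < k)%N ->
        nth 0 [seq v <- s | p a v] i \in [seq v <- s | p a v].
      by move=> ik; rewrite mem_nth // size_filter (leq_trans ik).
    have pk (i : 'I_k) : p a (nth 0 [seq v <- s | p a v] i).
      by have := tk i (ltn_ord i); rewrite mem_filter => /andP[].
    (* For [k = 0] no [pk] supplies a point of [U]; the Schur property does. *)
    case: k kc tk pk => [|k] kc tk pk.
      have [a0 [_ [Ua0 _ _]]] := schu _ uU.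
      by exists a0, (fun=> a0); split=> // -[].
    exists a, (fun i => nth 0 [seq v <- s | p a v] i); split.
    - move=> i j /eqP; rewrite nth_uniq ?filter_uniq //.
      + by move/eqP/val_inj.
      + by rewrite size_filter (leq_trans (ltn_ord i)).
      + by rewrite size_filter (leq_trans (ltn_ord j)).
    - by have /asboolP[] := pk ord0.
    - by move=> i; have /asboolP[] := pk i.
    - by move=> i; have /asboolP[] := pk i.
  rewrite (leq_trans _ cp) //.
  (* The point [a + a] occurs at most once in [s], so it raises the out-degree by at most one. *)
  rewrite (@eq_count _ _ (predU (p a) (pred1 (a + a)))) // -addn1.
  rewrite -(leq_add2r (count (predI (p a) (pred1 (a + a))) s)) count_predUI.
  rewrite -addnA leq_add2l (leq_trans _ (leq_addr _ _)) //.
  by rewrite count_uniq_mem // leq_b1.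
have [c cP] := sparse_digraph_coloring_infinite outd.
have [j uj] := ultra_color_class c uu.
(* Discarding [0] ensures [a <> a + a], so the edge between them is not a loop. *)
have u0 := free_ultrafilter_setC1 0 uu fu.
have [a [b [[Ua [aj a0]] [Ub [bj b0]] [Uab [abj ab0]]]]] :=
  schu _ (filterI uU (filterI uj u0)).
have [ab|ab] := eqVneq a b.
  rewrite -ab in abj.
  have : c a != c (a + a).
    apply: cP; first by rewrite /e eqxx orbT.
    by rewrite -{1}[a]addr0 (inj_eq (addrI a)) eq_sym; apply/eqP.
  by rewrite [c a]aj [c (a + a)]abj eqxx.
have : c a != c b by apply: cP => //; apply/orP; left; apply/asboolP.
by rewrite [c a]aj [c b]bj eqxx.
Qed.

End Stars.

(** * Enumerations and surjective colorings *)

Lemma infinite_enumeration (T : Type) (A : set T) :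
  countable A -> infinite_set A ->
  exists x : nat -> T, injective x /\ A = range x.
Proof.
elim/Ppointed: T => T in A *; first by rewrite emptyE => _ /(_ (finite_set0 _)).
move=> cA /infiniteP iA.
have /card_set_bijP[x [xA xi xs]] : ([set: nat] #= A)%card.
  by rewrite card_eq_le iA.
exists x; split; first by move=> i j; apply: xi; rewrite inE.
by apply/seteqP; split=> [a /xs//|_ [i _ <-]]; apply: xA.
Qed.

Lemma card_le_ord_inj (T : Type) r (X : set T) : (`I_r #<= X)%card ->
  exists f : 'I_r -> T, injective f /\ forall i, X (f i).
Proof.
move=> /card_leP[f].
have mr (i : 'I_r) : (i : nat) \in `I_r by rewrite inE /=.
exists (fun i => set_val (f (SigSub (mr i)))); split=> [i j /val_inj fij|i].
  apply: val_inj.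
  by have := 'inj_f (mem_set I) (mem_set I) fij => /(congr1 val).
exact: set_valP.
Qed.

(* Two points of X of the same color exist as long as some color is missed;
   recoloring one of them by the missed color reduces the number of missed
   colors. *)
Lemma coloring_refinement (T : Type) r (X : set T) (c : T -> 'I_r) :
  (`I_r #<= X)%card -> exists c' : T -> 'I_r, is_coloring X c' /\
    forall y z, X y -> X z -> c' y = c' z -> c y = c z.
Proof.
move=> /card_le_ord_inj[f [fi fX]].
pose missed (c : T -> 'I_r) := [pred j | `[< ~ (c @` X) j >]].
elim: {c}_.+1 {-2}c (ltnSn #|missed c|) => // n IHn c.
rewrite ltnS => cn.
have [sc|nsc] := pselect (is_coloring X c); first by exists c.
have [j jN] : exists j, ~ (c @` X) j.
  apply: contrapT => nj; apply: nsc => j _; apply: contrapT => jN.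
  by apply: nj; exists j.
(* An injective self-map of ['I_r] would be onto and hit [j]. *)
have ninj : ~ injective (c \o f).
  move=> cfi; apply: jN; have /codomP[i ->] := injF_onto cfi j.
  by exists (f i).
have [i [i' [cii' ii']]] : exists i i', c (f i) = c (f i') /\ i <> i'.
  apply: contrapT => ni; apply: ninj => i i' /= cii'.
  by apply: contrapT => ii'; apply: ni; exists i, i'.
pose c1 z := if `[< z = f i >] then j else c z.
have c1i : c1 (f i) = j by rewrite /c1 asboolT.
have c1N z : z <> f i -> c1 z = c z by move=> zi; rewrite /c1 asboolF.
have [|c' [sc' c'c1]] := IHn c1.
  rewrite (leq_trans _ cn) //; apply: proper_card; apply/properP; split.
    apply/fintype.subsetP => j' /asboolP j'N; apply/asboolP.
    move=> [z Xz czj']; apply: j'N.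
    have [zi|zi] := pselect (z = f i); last by exists z => //; rewrite c1N.
    (* The former color of [f i] survives at [f i']. *)
    exists (f i'); first exact: fX.
    by rewrite c1N -?czj' ?zi // => /fi /esym.
  exists j; first exact/asboolP.
  by apply/asboolP => /(_ _); apply; exists (f i).
exists c'; split=> // y z Xy Xz /(c'c1 _ _ Xy Xz).
(* Since [c] misses [j] on [X], only [f i] has color [j] under [c1]. *)
have [yi|yi] := pselect (y = f i); have [zi|zi] := pselect (z = f i).
- by rewrite yi zi.
- by rewrite yi c1i c1N // => jz; case: jN; exists z.
- by rewrite zi c1i c1N // => jy; case: jN; exists y.
- by rewrite !c1N.
Qed.

(** * From Schur ultrafilters to Schur sequences *)

Section SchurUltrafilters.
Variable G : zmodType.
Implicit Types (A B : set G) (u : set_system G) (x : nat -> G).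

(** Otherwise all long initial segments have bad colorings. Their limit [l] has a star in a color
    class, and on this finite star [l] agrees with a bad coloring. *)
Lemma schur_ultrafilter_sequence u x : injective x ->
  schur_ultrafilter u -> free_filter u -> u (range x) -> schur_sequence x.
Proof.
move=> xi su fu ux r k; apply: contrapT => noS.
have [uu _] := su.
have card_x n : (r <= n)%N -> (`I_r #<= initial_segment x n)%card.
  move=> rn; apply: (@card_le_trans _ _ _ `I_n.+1).
    by rewrite card_le_II leqW.
  by have /card_eqPle[] := inj_card_eq (A := `I_n.+1) (in2W xi).
have /choice[c cN] : forall n, exists c : G -> 'I_r,
    (r <= n)%N -> ~ schur_configuration k (initial_segment x n) c.
  (* For [n < r] any function will do; [n < r] makes ['I_r] inhabited. *)
  move=> n; have [rn|nr] := leqP r n; last first.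
    by exists (fun=> Ordinal (leq_ltn_trans (leq0n n) nr)).
  apply: contrapT => nc; apply: noS; exists n; split; first exact: card_x.
  by move=> c _; apply: contrapT => cN; apply: nc; exists c.
have /choice[ix ixP] : forall g, exists n, range x g -> x n = g.
  move=> g; have [[n _ <-]|gN] := pselect (range x g); first by exists n.
  by exists 0%N.
(* The summand [r] guarantees enough points for [cN]; the maximum puts the points of [s] in
   [range x] into the segment. *)
pose bound (s : seq G) := (r + \max_(g <- s) ix g)%N.
have [l lP] := limit_coloring (c \o bound).
have [j uj] := ultra_color_class l uu.
have [a [b [bi [xa la] Bb Bab]]] :=
  schur_ultrafilter_star k su fu (filterI ux uj).
have [s ss cs] := lP (a :: codom b ++ codom (fun i => a + b i)).
have as_ : a \in a :: codom b ++ codom (fun i => a + b i) by rewrite mem_head.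
have bs i : b i \in a :: codom b ++ codom (fun i => a + b i).
  by rewrite inE mem_cat codom_f orbT.
have abs i : a + b i \in a :: codom b ++ codom (fun i => a + b i).
  by rewrite inE mem_cat (codom_f (fun i => a + b i)) !orbT.
have seg g : range x g -> l g = j ->
    g \in a :: codom b ++ codom (fun i => a + b i) ->
    (initial_segment x (bound s) `&` c (bound s) @^-1` [set j]) g.
  move=> xg lg gs; split; last by rewrite /= -lg -cs.
  exists (ix g); last exact: ixP.
  by rewrite /= (leq_trans _ (leq_addl _ _)) // leq_bigmax_seq // ss.
apply: (cN (bound s)); first exact: leq_addr.
apply/schur_configurationP; exists j, a, b; split=> //.
- exact: seg.
- by move=> i; have [xb lb] := Bb i; apply: seg.
- by move=> i; have [xb lb] := Bab i; apply: seg.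
Qed.

(** * Large sets and partition regularity *)

(** One color must serve all [k]; arbitrary finite types of colors allow product colorings. *)
Definition large B : Prop := forall (I : finType) (c : G -> I),
  exists j, forall k, star k (B `&` c @^-1` [set j]).

Lemma large_subset A B : A `<=` B -> large A -> large B.
Proof.
move=> AB lA I c; have [j jP] := lA I c; exists j => k.
by apply: star_subset (jP k); apply: setSI.
Qed.

Lemma large_setU A B : large (A `|` B) -> large A \/ large B.
Proof.
move=> lAB; apply: contrapT => /not_orP[nA nB].
have [I [c cN]] : exists (I : finType) (c : G -> I),
    forall j, ~ forall k, star k (A `&` c @^-1` [set j]).
  apply: contrapT => nc; apply: nA => I c; apply: contrapT => cN.
  by apply: nc; exists I, c => j jP; apply: cN; exists j.
have [J [d dN]] : exists (J : finType) (d : G -> J),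
    forall j, ~ forall k, star k (B `&` d @^-1` [set j]).
  apply: contrapT => nc; apply: nB => J d; apply: contrapT => dN.
  by apply: nc; exists J, d => j jP; apply: dN; exists j.
(* The Boolean component forces each star into [A] or into [B]. *)
have [[[i j] []] ijP] := lAB _ (fun g => (c g, d g, `[< A g >])).
  apply: (cN i) => k; apply: star_subset (ijP k) => g [_ /= [<- _ gA]].
  by split=> //; apply/asboolP; rewrite gA.
apply: (dN j) => k; apply: star_subset (ijP k) => g [ABg /= [_ <- gA]].
by split=> //; case: ABg => // Ag; rewrite asboolT in gA.
Qed.

Lemma large_nontrivial B : large B -> exists y z, [/\ B y, B z & y <> z].
Proof.
move=> lB; have [j /(_ 2%N)[a [b [bi _ Bb _]]]] := lB _ (fun=> tt).
exists (b ord0), (b ord_max); split; [exact: (Bb _).1|exact: (Bb _).1|].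
by move=> /bi.
Qed.

(** If every color [j] failed at some [k j], the maximum of these would contradict the Schur
    property for a surjective refinement of [c]. *)
Lemma schur_set_large A : schur_set A -> large A.
Proof.
move=> [x [-> sx]] I c; apply: contrapT => nc.
have /choice[k kN] : forall j, exists k, ~ star k (range x `&` c @^-1` [set j]).
  move=> j; apply/existsNP => jP; apply: nc; exists j; exact: jP.
have [S [cardS SP]] := sx #|I| (\max_j k j)%N.
have [c' [sc' c'c]] := coloring_refinement (enum_rank \o c) cardS.
have /schur_configurationP[i st] := SP c' sc'.
have [a [_ [_ [Xa c'a] _ _]]] := st.
apply: (kN (c a)); apply: star_leq (leq_bigmax (c a)) _.
apply: star_subset st => g [Xg c'g]; split.
  by case: Xg => n _ <-; exists n.
by apply: enum_rank_inj; apply: c'c => //; rewrite c'g.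
Qed.

Lemma large_schur_ultrafilter A : large A ->
  exists u, [/\ schur_ultrafilter u, free_filter u & u A].
Proof.
move=> lA.
have nlarge0 : ~ large (set0 : set G) by move=> /large_nontrivial[y [z []]].
(* Members of [F] contain [A] up to a set that is not large; [large_setU] gives closure under
   intersection. *)
pose F : set_system G := [set U | ~ large (A `\` U)].
have FF : ProperFilter F.
  split; first by apply; rewrite setD0.
  split; first by rewrite /F /= setDT.
    move=> U V FU FV; rewrite /F /= setDIr.
    by move=> /large_setU[]; [exact: FU|exact: FV].
  by move=> U V UV FU lV; apply: FU; apply: large_subset lV; apply: setDS.
have [u [uu Fu]] := ultraFilterLemma FF.
have ularge U : u U -> large U.
  move=> uU; apply: contrapT => nU.
  (* If [U] is not large, neither is its part in [A], so its complement lies in [F]. *)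
  have uNU : u (~` U).
    apply: Fu => lU; apply: nU; apply: large_subset lU => z [_ NNUz].
    exact: contrapT.
  by have [z []] := filter_ex (filterI uU uNU).
exists u; split.
- split=> // U /ularge lU.
  have [j /(_ 1%N)[a [b [_ Ua Ub Uab]]]] := lU _ (fun=> tt).
  by exists a, (b ord0); split; [exact: Ua.1|exact: (Ub _).1|exact: (Uab _).1].
- apply/seteqP; split=> // g gu.
  have uN : u (~` [set g]).
    (* Only [g] can remain of [A] here, but large sets have two points. *)
    apply: Fu => lg; have [y [z [[_ /= yg] [_ /= zg]]]] := large_nontrivial lg.
    by apply; transitivity g; [|symmetry]; exact: contrapT.
  exact: (gu _ uN erefl).
- by apply: Fu; rewrite /F /= setDv.
Qed.

End SchurUltrafilters.

Theorem theorem1p8 (G : zmodType) (hG : countable [set: G]) (A : set G) :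
  (exists u : set_system G, [/\ schur_ultrafilter u, free_filter u & u A])
  <-> schur_set A.
Proof.
split=> [[u [su fu uA]]|/schur_set_large]; last exact: large_schur_ultrafilter.
have cA := sub_countable (subset_card_le (@subsetT _ A)) hG.
(* An injective enumeration makes initial segments grow past any [r]. *)
have [|x [xi Ax]] := infinite_enumeration cA.
  by apply: free_ultrafilter_infinite fu uA; case: su.
exists x; split=> //; rewrite Ax in uA.
exact: schur_ultrafilter_sequence xi su fu uA.
Qed.
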